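(* Let $n,s\ge 1$ be integers. The volume (Lebesgue measure in $\mathbb{R}^{ns}$) of the $(n,s)$-Everest polytope $\mathcal{E}_{n,s}$ is $$\operatorname{vol}(\mathcal{E}_{n,s})=\frac{((n+1)s)!}{(ns)!\,(s!)^{n+1}}.$$
   Context: The $(n,s)$-Everest polytope is $\mathcal{E}_{n,s}=\{\mathbf{x}\in\mathbb{R}^{ns}\mid g_{n,s}(\mathbf{x})\le 1\}$, where $g_{n,s}:\mathbb{R}^{ns}\to\mathbb{R}$ is defined, for $\mathbf{x}=(x_{1,1},\ldots,x_{n,s})$, by $$g_{n,s}(\mathbf{x})=\sum_{j=1}^s\max\{0,x_{1,j},\ldots,x_{n,j}\}+\max\Big\{0,-\sum_{j=1}^s x_{1,j},\ldots,-\sum_{j=1}^s x_{n,j}\Big\}.$$ *)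

(* Defs.v *)
From HB Require Import structures.
From mathcomp Require Import all_boot all_order all_algebra.
From mathcomp Require Import all_classical all_reals all_analysis.
From mathcomp Require Import measurable_realfun.

Set Implicit Arguments.
Unset Strict Implicit.
Unset Printing Implicit Defensive.
Import Order.TTheory GRing.Theory Num.Theory.
Import numFieldNormedType.Exports.

Local Open Scope classical_set_scope.
Local Open Scope ring_scope.

(* R^d is d.-tuple (measurableTypeR R), which carries the product (i.e. Borel)
   sigma-algebra.  Lebesgue measure on R^d.+1 is the product of Lebesgue
   measure on R with Lebesgue measure on R^d, transported along the
   identification (a, x) |-> a :: x of R * R^d with R^d.+1. *)

Section lebesgue_cons.
Context {R : realType} (d : nat).
Local Notation Rt := (measurableTypeR R).

Definition cons_tuple_of (p : Rt * d.-tuple Rt) : d.+1.-tuple Rt :=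
  [the d.+1.-tuple Rt of p.1 :: p.2].

Let measurable_cons_tuple_of :
  measurable_fun [set: Rt * d.-tuple Rt] cons_tuple_of.
Proof. exact: measurable_cons measurable_fst measurable_snd. Qed.

Variable mu : {sigma_finite_measure set (d.-tuple Rt) -> \bar R}.

Definition lebesgue_cons : set (d.+1.-tuple Rt) -> \bar R :=
  pushforward (@lebesgue_measure R \x mu)%E cons_tuple_of.

Let lebesgue_cons0 : lebesgue_cons set0 = 0%E.
Proof. by rewrite /lebesgue_cons /pushforward preimage_set0 measure0. Qed.

Let lebesgue_cons_ge0 A : (0 <= lebesgue_cons A)%E.
Proof. exact: measure_ge0. Qed.

Let lebesgue_cons_sigma_additive : semi_sigma_additive lebesgue_cons.
Proof.
move=> F mF tF mUF; rewrite /lebesgue_cons /pushforward preimage_bigcup.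
apply: measure_semi_sigma_additive.
- by move=> k; rewrite -[X in measurable X]setTI; exact: measurable_cons_tuple_of.
- apply/trivIsetP => /= i j _ _ ij; rewrite -preimage_setI.
  by move/trivIsetP : tF => /(_ _ _ _ _ ij) ->//; rewrite preimage_set0.
- rewrite -preimage_bigcup -[X in measurable X]setTI.
  exact: measurable_cons_tuple_of.
Qed.

HB.instance Definition _ := isMeasure.Build _ _ _ lebesgue_cons
  lebesgue_cons0 lebesgue_cons_ge0 lebesgue_cons_sigma_additive.

Let lebesgue_cons_sigma_finite : sigma_finite setT lebesgue_cons.
Proof.
have /sigma_finiteP[F [FT ndF Foo]] := sigma_finiteT (@lebesgue_measure R).
have /sigma_finiteP[G [GT ndG Goo]] := sigma_finiteT mu.
pose u (x : d.+1.-tuple Rt) : Rt * d.-tuple Rt := (thead x, [tuple of behead x]).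
have uK p : u (cons_tuple_of p) = p.
  by case: p => a x; rewrite /u theadE; congr pair; apply/val_inj.
have mu_u : measurable_fun [set: d.+1.-tuple Rt] u.
  apply/measurable_fun_pairP; split; first exact: measurable_tnth.
  exact: measurable_behead.
exists (fun k => u @^-1` (F k `*` G k)).
  apply/esym; rewrite -subTset => x _.
  have [i _ Fi] : (\bigcup_k F k) (u x).1 by rewrite -FT.
  have [j _ Gj] : (\bigcup_k G k) (u x).2 by rewrite -GT.
  exists (maxn i j) => //; split.
    by move: Fi; exact/subsetPset/ndF/leq_maxl.
  by move: Gj; exact/subsetPset/ndG/leq_maxr.
move=> k; have [mF Fk] := Foo k; have [mG Gk] := Goo k; split.
  by rewrite -[X in measurable X]setTI; apply: mu_u => //; exact: measurableX.
rewrite /lebesgue_cons /pushforward.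
rewrite (_ : _ @^-1` _ = F k `*` G k); last first.
  by apply/seteqP; split => p; rewrite /preimage /mkset uK.
by rewrite product_measure1E// lte_mul_pinfty// ge0_fin_numE.
Qed.

HB.instance Definition _ := Measure_isSigmaFinite.Build _ _ _ lebesgue_cons
  lebesgue_cons_sigma_finite.

End lebesgue_cons.

Fixpoint lebesgue_tuple (R : realType) (d : nat) :
    {sigma_finite_measure set (d.-tuple (measurableTypeR R)) -> \bar R} :=
  match d with
  | 0 => \d_[tuple]
  | d'.+1 => lebesgue_cons (lebesgue_tuple R d')
  end.

Lemma lebesgue_tuple_box (R : realType) (d : nat)
    (A : 'I_d -> set (measurableTypeR R)) :
  (forall i, measurable (A i)) ->
  lebesgue_tuple R d [set x | forall i, A i (tnth x i)] =
  (\prod_(i < d) lebesgue_measure (A i))%E.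
Proof.
elim: d A => [|d IH] A mA.
  rewrite big_ord0 /= diracE mem_set//=.
  by case.
rewrite big_ord_recl /= /lebesgue_cons /pushforward -IH//.
rewrite -product_measure1E//.
  congr (_ _); apply/seteqP; split => [[a x] /= Aax|[a x] /= [Aa Ax] i].
    split; first exact: (Aax ord0).
    by move=> i; have := Aax (lift ord0 i); rewrite tnthS.
  case: (unliftP ord0 i) => [j ->|->//].
  by rewrite tnthS.
rewrite (_ : [set x | _] = \bigcap_(i in [set: 'I_d])
    ((fun x : d.-tuple (measurableTypeR R) => tnth x i) @^-1`
     A (lift ord0 i))).
  apply: fin_bigcap_measurable => // i _.
  by rewrite -[X in measurable X]setTI; exact: measurable_tnth.
by apply/seteqP; split => x /= Ax i; [move=> _|]; exact: Ax.
Qed.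

Section everest.
Context {R : realType} (n s : nat).
Local Notation Rns := ((n * s).-tuple (measurableTypeR R)).

(* The entries x_{i,j} of x are listed row by row. *)
Definition everest_coord (x : Rns) (i : 'I_n) (j : 'I_s) : R :=
  tnth x (mxvec_index i j).

(* \big[Num.max/0]_(i < n) a i is max {0, a_1, ..., a_n}. *)
Definition everest_fun (x : Rns) : R :=
  \sum_(j < s) \big[Num.max/0]_(i < n) everest_coord x i j +
  \big[Num.max/0]_(i < n) (- \sum_(j < s) everest_coord x i j).

Definition everest : set Rns := [set x | everest_fun x <= 1].

Let measurable_bigmax (F : 'I_n -> Rns -> R) :
  (forall i, measurable_fun setT (F i)) ->
  measurable_fun setT (fun x => \big[Num.max/0]_(i < n) F i x).
Proof.
move=> mF; elim: (index_enum _) => [|i r IH].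
  by under eq_fun do rewrite big_nil; exact: measurable_cst.
by under eq_fun do rewrite big_cons; exact: measurable_maxr.
Qed.

Lemma measurable_everest : measurable everest.
Proof.
have mc i j : measurable_fun setT (fun x => everest_coord x i j).
  exact: measurable_tnth.
have mf : measurable_fun setT everest_fun.
  apply: measurable_funD.
    by apply: measurable_sum => j; exact: measurable_bigmax.
  apply: measurable_bigmax => i; apply: measurableT_comp => //.
  by apply: measurable_sum => j; exact: mc.
rewrite (_ : everest = everest_fun @^-1` `]-oo, 1]%classic).
  by rewrite -[X in measurable X]setTI; apply: mf => //; exact: measurable_itv.
by apply/seteqP; split => x; rewrite /everest /= in_itv.
Qed.

End everest.

Arguments everest : clear implicits.
Arguments measurable_everest : clear implicits.

(* Main.v *)
(* Adjoin to the matrix x a zero row x_0.  Then g_{n,s}(x) is the sum over the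
   columns j of max_m x_{m,j}, minus min_m of the row sums.  Subtracting every
   column from its maximum gives a nonnegative matrix u with a zero in each
   column, and g_{n,s}(x) is the largest row sum of u.  Hence the functions phi
   giving the row of the (first) maximum of each column cut the polytope into
   pieces; on the piece of phi, passing from x to the entries of u outside the
   graph of phi preserves the volume, and the image is a product over the rows
   m of standard simplices of dimension s - k_m, where k_m is the number of j
   with phi j = m.  The volume is therefore the sum over phi of
   prod_m 1 / (s - k_m)!, which Vandermonde's identity for falling factorials
   evaluates. *)
Require Import Defs.
From mathcomp Require Import all_boot all_order all_algebra all_fingroup.
From mathcomp Require Import all_classical all_reals all_analysis.
From mathcomp Require Import measurable_realfun.
From mathcomp Require Import ring lra.

Set Implicit Arguments.
Unset Strict Implicit.
Unset Printing Implicit Defensive.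
Import Order.TTheory GRing.Theory Num.Theory.
Import numFieldNormedType.Exports.
Local Open Scope ring_scope.
Local Open Scope classical_set_scope.

(** * Vandermonde's identity for falling factorials *)

Definition ffun_cons (T : finType) r (p : T * {ffun 'I_r -> T}) :
    {ffun 'I_r.+1 -> T} :=
  [ffun j => if unlift ord0 j is Some j' then p.2 j' else p.1].

Lemma ffun_cons_bij (T : finType) r : bijective (@ffun_cons T r).
Proof.
exists (fun f : {ffun 'I_r.+1 -> T} => (f ord0, [ffun j => f (lift ord0 j)]))
  => [[m f]|f] /=.
  rewrite ffunE unlift_none; congr pair.
  by apply/ffunP => j; rewrite !ffunE liftK.
apply/ffunP => j; rewrite ffunE; case: unliftP => [j' ->|->] //=.
by rewrite ffunE.
Qed.

(** Both sides count the injections of ['I_r] into a disjoint union of blocks of sizes [a m], sorted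
    on the left by the block of each image. In the induction, the image of the first element is
    removed from its block. *)
Lemma sum_prod_ffact (T : finType) r (a : T -> nat) :
  (\sum_(f : {ffun 'I_r -> T}) \prod_m a m ^_ #|[pred j | f j == m]| =
   (\sum_m a m) ^_ r)%N.
Proof.
elim: r a => [|r IH] a.
  rewrite ffactn0.
  rewrite (big_pred1 [ffun j : 'I_0 => False_rect T (notF (ltn_ord j))]) ?big1
    => [//|m _|f].
    by rewrite eq_card0// => -[].
  by apply/esym/eqP/ffunP => -[].
rewrite (reindex (@ffun_cons T r)) /=; last exact/onW_bij/ffun_cons_bij.
rewrite -(pair_bigA _ (fun m f =>
  \prod_m0 a m0 ^_ #|[pred j | ffun_cons (m, f) j == m0]|)) /=.
rewrite ffactnS big_distrl /=; apply: eq_bigr => m _.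
(* For an empty block both terms vanish; otherwise the truncated predecessors in [nat] are
   genuine. *)
have [am0|am0] := posnP (a m).
  rewrite am0 big1 // => f _; rewrite (bigD1 m) //= am0 (cardD1 ord0).
  by rewrite inE ffunE unlift_none eqxx.
transitivity (a m * \sum_(f : {ffun 'I_r -> T})
   \prod_m' (a m' - (m' == m)) ^_ #|[pred j | f j == m']|)%N; last first.
  rewrite IH; congr (_ * _ ^_ _)%N.
  rewrite (bigD1 m)//= [in RHS](bigD1 m)//= eqxx -subn1 -addnBAC//.
  by congr addn; apply: eq_bigr => i /negbTE ->; rewrite subn0.
rewrite big_distrr; apply: eq_bigr => f _ /=.
have card_cons m' : #|[pred j | ffun_cons (m, f) j == m']| =
    ((m == m') + #|[pred j | f j == m']|)%N.
  rewrite -!sum1_card !big_mkcond big_ord_recl inE ffunE unlift_none /=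
    [in RHS]big_mkcond.
  by congr addn; apply: eq_bigr => j _; rewrite !inE ffunE liftK.
rewrite (bigD1 m)//= [in RHS](bigD1 m)//=.
rewrite card_cons eqxx add1n ffactnS subn1 mulnA.
congr muln; apply: eq_bigr => i im.
by rewrite card_cons eq_sym (negbTE im) subn0.
Qed.

(** Times the (n+1)-st power of s!, each factor becomes [s ^_ k] with [k] a fibre size, so that
    [sum_prod_ffact] applies with n+1 blocks of size [s]. *)
Lemma sum_prod_inv_fact (R : numFieldType) n s :
  \sum_(f : {ffun 'I_s -> 'I_n.+1}) \prod_m
     ((s - #|[pred j | f j == m]|)`!%:R)^-1 =
  (n.+1 * s)`!%:R / ((n * s)`!%:R * s`!%:R ^+ n.+1) :> R.
Proof.
have f0 k : (k`!%:R : R) != 0 by rewrite pnatr_eq0 -lt0n fact_gt0.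
apply: (mulIf (expf_neq0 n.+1 (f0 s))).
rewrite invfM mulrA divfK ?expf_neq0//.
rewrite mulrC mulr_sumr.
transitivity (((n.+1 * s) ^_ s)%:R : R); last first.
  rewrite -(@ffact_fact (n.+1 * s) s) ?mulSn ?leq_addr// addKn natrM mulfK//.
have -> : (n.+1 * s = \sum_(m < n.+1) s)%N by rewrite sum_nat_const card_ord.
rewrite -sum_prod_ffact natr_sum.
apply: eq_bigr => f _.
have -> : s`!%:R ^+ n.+1 = \prod_(m < n.+1) s`!%:R :> R.
  by rewrite prodr_const card_ord.
rewrite -big_split natr_prod /=; apply: eq_bigr => m _.
have le : (#|[pred j | f j == m]| <= s)%N.
  by rewrite -[s in (_ <= s)%N]card_ord max_card.
by rewrite -(ffact_fact le) natrM mulfK.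
Qed.

(** * Reflections, iterated integrals and shears *)

Lemma lebesgue_measure_reflection (R : realType) (c : R)
    (A : set (measurableTypeR R)) : measurable A ->
  lebesgue_measure ((fun a : R => c - a) @^-1` A) = lebesgue_measure A.
Proof.
pose f (a : measurableTypeR R) : measurableTypeR R := c - a.
have mf : measurable_fun setT f by exact: measurable_funB.
move=> mA; rewrite -/(pushforward lebesgue_measure f A).
(* Uniqueness of Lebesgue measure leaves half-open intervals, whose closed end the reflection
   swaps. *)
apply/esym/lebesgue_measure_unique => //= _ /ocitvP[->|[[x y]/= xy ->]].
  by rewrite /pushforward preimage_set0 !measure0.
rewrite /pushforward /f.
rewrite (_ : _ @^-1` _ = `[c - y, c - x[); last first.
  apply/seteqP; split => a; rewrite /= !in_itv/= => /andP[? ?];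
  by apply/andP; split; lra.
rewrite !lebesgue_measure_itv/= !lte_fin xy ifT; last by lra.
by rewrite -!EFinD; congr EFin; ring.
Qed.

Section lebesgue_tuple_fubini.
Context {R : realType} (d : nat).
Local Notation Rt := (measurableTypeR R).
Local Notation Rd := (d.-tuple Rt).
Local Notation RSd := (d.+1.-tuple Rt).
Implicit Type A : set RSd.

Lemma measurable_cons_tuple_of : measurable_fun setT (@cons_tuple_of R d).
Proof. exact: measurable_cons measurable_fst measurable_snd. Qed.

Lemma measurable_cons_section A (a : Rt) : measurable A ->
  measurable [set x : Rd | A (cons_tuple_of (a, x))].
Proof.
move=> mA; rewrite -[X in measurable X]setTI.
by apply: (@measurable_cons _ _ _ _ (fun=> a) _ id).
Qed.

Lemma lebesgue_tupleS A : lebesgue_tuple R d.+1 A =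
  (\int[lebesgue_measure]_a
     lebesgue_tuple R d [set x : Rd | A (cons_tuple_of (a, x))])%E.
Proof.
apply: eq_integral => a _ /=.
by rewrite xsectionE.
Qed.

(** By uniqueness of the product measure, the first coordinate, outermost in the construction, can
    be integrated innermost. *)
Lemma lebesgue_tupleS_swap A : measurable A -> lebesgue_tuple R d.+1 A =
  (\int[lebesgue_tuple R d]_x
     lebesgue_measure [set a : Rt | A (cons_tuple_of (a, x))])%E.
Proof.
move=> mA.
have mB : measurable (@cons_tuple_of R d @^-1` A).
  by rewrite -[X in measurable X]setTI; apply: measurable_cons_tuple_of.
transitivity ((lebesgue_measure \x^ lebesgue_tuple R d)%E
                (@cons_tuple_of R d @^-1` A)).
  rewrite /= /lebesgue_cons /pushforward.
  by apply: product_measure_unique => // B C mC mD; rewrite /= product_measure2E.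
by apply: eq_integral => a _ /=; rewrite ysectionE.
Qed.

End lebesgue_tuple_fubini.

Lemma integral_subr_exprn (R : realType) (t : R) (k : nat) : 0 <= t ->
  (\int[lebesgue_measure]_(a in `[0%R, t]) ((t - a) ^+ k / k`!%:R)%:E =
   (t ^+ k.+1 / k.+1`!%:R)%:E)%E.
Proof.
rewrite le_eqVlt => /predU1P[<-|t0].
  by rewrite set_itv1 integral_set1 expr0n mul0r.
(* An antiderivative vanishing at [t], so that the integral is [- F 0]. *)
pose F := fun a : R => - ((t - a) ^+ k.+1 / k.+1`!%:R).
have dF a : is_derive a (1:R) F ((t - a) ^+ k / k`!%:R).
  have -> : F = - (k.+1`!%:R^-1 *: ((cst t - id) ^+ k.+1)).
    by apply/funext => x; rewrite /F [RHS]/= !fctE mulrC.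
  apply: is_derive_eq.
  rewrite factS natrM invfM sub0r /= !scalerA.
  have k0 : k.+1%:R != 0 :> R by rewrite pnatr_eq0.
  rewrite -[_ *: _]/(_ * _) mulrN1 opprK mulrA [X in X * _]mulrAC.
  by rewrite mulVf// mul1r mulrC.
have cF : continuous F.
  move=> a; apply: differentiable_continuous.
  apply/derivable1_diffP.
  exact: ex_derive.
rewrite (@continuous_FTC2 _ _ F)//.
- by rewrite -EFinB /F subrr expr0n mul0r oppr0 sub0r opprK addr0.
- apply: continuous_subspaceT => b.
  apply: cvgM; last exact: cvg_cst.
  apply: (@cvg_comp _ _ _ (fun x => t - x) (fun x => x ^+ k)).
    by apply: cvgB; [exact: cvg_cst|exact: cvg_id].
  exact: exprn_continuous.
- split.
  + by move=> a _; exact: ex_derive.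
  + by apply: cvg_at_right_filter; exact: cF.
  + by apply: cvg_at_left_filter; exact: cF.
- by move=> a _; rewrite derive1E; exact: derive_val.
Qed.

Section shear.
Context {R : realType}.
Local Notation Rt := (measurableTypeR R).

Definition shear d (P : pred 'I_d) (g : 'I_d -> d.-tuple Rt -> Rt)
    (x : d.-tuple Rt) : d.-tuple Rt :=
  [tuple if P c then g c x - tnth x c else tnth x c | c < d].

Lemma measurable_shear d (P : pred 'I_d) (g : 'I_d -> d.-tuple Rt -> Rt) :
  (forall c, measurable_fun setT (g c)) -> measurable_fun setT (shear P g).
Proof.
move=> mg; apply/measurable_fun_tnthP => c.
rewrite (_ : _ \o _ = fun x => if P c then g c x - tnth x c else tnth x c).
  2: by apply/funext => x; rewrite /= tnth_mktuple.
case: (P c) => /=; last exact: measurable_tnth.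
apply: measurable_funB; first exact: mg.
exact: measurable_tnth.
Qed.

(** Once the coordinates outside [P] are fixed, [g] is constant and the map is a product of
    reflections. The induction peels off the first coordinate. *)
Lemma lebesgue_tuple_shear d (P : pred 'I_d) (g : 'I_d -> d.-tuple Rt -> Rt)
    (A : set (d.-tuple Rt)) :
  (forall c, measurable_fun setT (g c)) ->
  (forall c x y, (forall i, ~~ P i -> tnth x i = tnth y i) -> g c x = g c y) ->
  measurable A ->
  lebesgue_tuple R d (shear P g @^-1` A) = lebesgue_tuple R d A.
Proof.
elim: d P g A => [|d IH] P g A mg gP mA.
  congr (lebesgue_tuple R 0 _); apply/seteqP.
  by split => x; rewrite /= (_ : shear P g x = x)// [LHS]tuple0 [RHS]tuple0.
have mE : measurable (shear P g @^-1` A).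
  by rewrite -[X in measurable X]setTI; exact: measurable_shear.
pose P' c := P (lift ord0 c).
pose g' (a : Rt) c (x : d.-tuple Rt) := g (lift ord0 c) (cons_tuple_of (a, x)).
have mcons (a : Rt) :
    measurable_fun setT (fun x : d.-tuple Rt => cons_tuple_of (a, x)).
  exact: (@measurable_cons _ _ _ _ (fun=> a) _ id).
have mg' a c : measurable_fun setT (g' a c).
  by rewrite /g'; apply: measurableT_comp => //; exact: mg.
have g'P a c x y :
    (forall i, ~~ P' i -> tnth x i = tnth y i) -> g' a c x = g' a c y.
  move=> xy; apply: gP => i; case: (unliftP ord0 i) => [j ->|->] Pi.
    by rewrite /cons_tuple_of/= !tnthS; exact: xy.
  by [].
have [P0|P0] := boolP (P ord0).
(* The 0 is a placeholder: the first coordinate lies in [P], so [g] does not depend on it. *)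
- have shE a x : shear P g (cons_tuple_of (a, x)) =
      cons_tuple_of (g ord0 (cons_tuple_of (0, x)) - a, shear P' (g' 0) x).
    apply: eq_from_tnth => i; rewrite tnth_mktuple.
    case: (unliftP ord0 i) => [j ->|->].
      rewrite /cons_tuple_of/= !tnthS tnth_mktuple /g' /P'.
      by case: ifP => // _; congr (_ - _); apply: gP => k;
         case: (unliftP ord0 k) => [l ->|->]; rewrite ?P0// !tnthS.
    rewrite P0 /cons_tuple_of/= !tnth0; congr (_ - _); apply: gP => k.
    by case: (unliftP ord0 k) => [l ->|->]; rewrite ?P0// !tnthS.
  (* Integrating over the reflected coordinate first, the reflection can be
     dropped; the remaining shear is then the same for every value of it. *)
  rewrite lebesgue_tupleS_swap//.
  pose h (z : d.+1.-tuple Rt) := shear P' (g' 0) [tuple of behead z].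
  pose B := [set z : d.+1.-tuple Rt | A (cons_tuple_of (thead z, h z))].
  have BE a x :
      B (cons_tuple_of (a, x)) = A (cons_tuple_of (a, shear P' (g' 0) x)).
    rewrite /B /= theadE; congr (A (cons_tuple_of (_, shear _ _ _))).
    exact: val_inj.
  have mB : measurable B.
    rewrite -[X in measurable X]setTI.
    apply: (@measurable_cons _ _ _ _ (@thead _ _) _ h) => //.
      exact: measurable_tnth.
    apply: measurableT_comp; first exact: measurable_shear.
    exact: measurable_behead.
  transitivity (lebesgue_tuple R d.+1 B).
    rewrite lebesgue_tupleS_swap//; apply: eq_integral => x _.
    pose C : set Rt := [set a | A (cons_tuple_of (a, shear P' (g' 0) x))].
    transitivity (lebesgue_measure C).
      rewrite -(@lebesgue_measure_reflection R (g ord0 (cons_tuple_of (0, x))) C);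
        last first.
        rewrite -[X in measurable X]setTI.
        exact: (@measurable_cons _ _ _ _ id _ (fun=> _)).
      by congr lebesgue_measure; apply/seteqP; split => a /=; rewrite shE.
    by congr lebesgue_measure; apply/seteqP; split => a /=; rewrite BE.
  rewrite !lebesgue_tupleS; apply: eq_integral => a _.
  rewrite -(IH P' (g' 0) _ (mg' 0) (@g'P 0) (measurable_cons_section a mA)).
  by congr (lebesgue_tuple R d _); apply/seteqP; split => x /=; rewrite BE.
(* A kept first coordinate [a] is a parameter of the remaining shear; the induction hypothesis
   applies for each [a]. *)
- have shE a x : shear P g (cons_tuple_of (a, x)) =
      cons_tuple_of (a, shear P' (g' a) x).
    apply: eq_from_tnth => i; rewrite tnth_mktuple.
    case: (unliftP ord0 i) => [j ->|->].
      by rewrite /cons_tuple_of/= !tnthS tnth_mktuple.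
    by rewrite (negbTE P0).
  rewrite !lebesgue_tupleS; apply: eq_integral => a _.
  rewrite -(IH P' (g' a) _ (mg' a) (@g'P a) (measurable_cons_section a mA)).
  by congr (lebesgue_tuple R d _); apply/seteqP; split => x /=; rewrite shE.
Qed.

End shear.

(** * Volume of a product of simplices *)

Section simplices.
Context {R : realType} (M : finType).
Local Notation Rt := (measurableTypeR R).

Definition simplices d (cls : 'I_d -> M) (st : pred 'I_d) (t : M -> R) :
    set (d.-tuple Rt) :=
  [set x | (forall c, (0 : R) < tnth x c ?<= if st c) /\
           forall m, \sum_(c < d | cls c == m) (tnth x c : R) <= t m].

Lemma measurable_simplices d (cls : 'I_d -> M) st t :
  measurable (simplices cls st t).
Proof.
pose S c : set (d.-tuple Rt) :=
  (fun x => tnth x c) @^-1` [set` Interval (BSide (st c) (0:R)) +oo%O].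
pose sum m (x : d.-tuple Rt) : R := \sum_(c < d | cls c == m) (tnth x c : R).
pose T m := sum m @^-1` [set` Interval -oo%O (BRight (t m))].
rewrite (_ : simplices cls st t =
    (\bigcap_(c in [set: 'I_d]) S c) `&` (\bigcap_(m in [set: M]) T m)).
  apply: measurableI; apply: fin_bigcap_measurable => // i _;
    rewrite -[X in measurable X]setTI.
    by apply: measurable_tnth => //; exact: measurable_itv.
  have : measurable_fun setT (sum i).
    rewrite /sum; under eq_fun do rewrite big_mkcond.
    apply: measurable_sum => c; case: (cls c == i) => //.
    exact: measurable_tnth.
  by apply => //; exact: measurable_itv.
apply/seteqP; split => x.
  by move=> [h1 h2]; split => i _; rewrite /S /T /sum /= in_itv/= ?andbT.
by move=> [h1 h2]; split => i; [have := h1 i I|have := h2 i I];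
  rewrite /S /T /sum /= in_itv/= ?andbT.
Qed.

(** Slicing at a first coordinate [a] of class [m0] leaves a product of the same kind with [t m0]
    lowered by [a]; integrating over [a] raises the exponent of [m0] by one. *)
Lemma lebesgue_tuple_simplices d (cls : 'I_d -> M) st t :
  (forall m, 0 <= t m) ->
  lebesgue_tuple R d (simplices cls st t) =
  (\prod_m (t m ^+ #|[pred c | cls c == m]| /
            (#|[pred c | cls c == m]|)`!%:R))%:E.
Proof.
elim: d cls st t => [|d IH] cls st t t0.
  rewrite [LHS]diracE mem_set; last first.
    by split => [[]//|m]; rewrite big_ord0.
  rewrite big1// => m _.
  by rewrite eq_card0 ?expr0 ?divr1// => -[].
pose m0 := cls ord0.
pose cls' c := cls (lift ord0 c).
pose st' c := st (lift ord0 c).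
pose t' a m := if m == m0 then t m - a else t m.
pose k m := #|[pred c | cls' c == m]|.
pose I0 := [set` Interval (BSide (st ord0) 0) (BRight (t m0))].
pose C : R := \prod_(m | m != m0) (t m ^+ k m / (k m)`!%:R).
pose f (a : R) : \bar R := (((t m0 - a) ^+ k m0 / (k m0)`!%:R) * C)%:E.
have C0 : 0 <= C by apply: prodr_ge0 => m _; rewrite divr_ge0// exprn_ge0.
have kE m : #|[pred c | cls c == m]| = ((m0 == m) + k m)%N.
  by rewrite /k -!sum1_card !big_mkcond big_ord_recl [in RHS]big_mkcond.
have sectionE a : [set x | simplices cls st t (cons_tuple_of (a, x))] =
    if a \in I0 then simplices cls' st' (t' a) else set0.
  have sumE x m :
      \sum_(c < d.+1 | cls c == m) (tnth (cons_tuple_of (a, x)) c : R) =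
      (if m == m0 then a else 0) + \sum_(c < d | cls' c == m) (tnth x c : R).
    rewrite big_mkcond big_ord_recl -big_mkcond/= eq_sym; congr (_ + _).
    rewrite big_mkcond [RHS]big_mkcond; apply: eq_bigr => c _.
    by rewrite tnthS.
  rewrite mem_setE; apply/seteqP; split => x.
    move=> [h1 h2].
    have h1' c : 0 < (tnth x c : R) ?<= if st' c.
      by have := h1 (lift ord0 c); rewrite /cons_tuple_of/= tnthS.
    have /= h10 := h1 ord0.
    rewrite /I0 in_itv /= h10 /=.
    have := h2 m0; rewrite sumE eqxx => h20.
    (* The other coordinates of the class are nonnegative, which forces [a <= t m0]. *)
    have s0 : 0 <= \sum_(c < d | cls' c == m0) (tnth x c : R).
      by apply: sumr_ge0 => c _; have := h1' c; exact: lteifW.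
    rewrite ifT; last by lra.
    split => // m; have := h2 m; rewrite sumE /t'; case: ifP => _; lra.
  case: ifPn => //; rewrite in_itv/= => /andP[h10 h20] [h1 h2].
  split => [c|m].
    case: (unliftP ord0 c) => [c' ->|->//].
    by rewrite /cons_tuple_of/= tnthS; exact: h1.
  by have := h2 m; rewrite sumE /t'; case: ifP => _; lra.
have mf D : measurable_fun D f.
  apply/measurable_EFinP; apply: measurable_funM => //.
  apply: measurable_funM => //; apply: measurable_funX; exact: measurable_funB.
transitivity (\int[lebesgue_measure]_(a in I0) f a)%E.
  rewrite lebesgue_tupleS [RHS]integral_mkcond; apply: eq_integral => a _.
  rewrite sectionE patchE; case: ifPn => [|_]; last by rewrite measure0.
  rewrite inE /I0 /= in_itv/= => /andP[a0 at0].
  rewrite IH.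
    rewrite /f /C (bigD1 m0)//= /t' eqxx; congr (_ * _)%:E.
    by apply: eq_bigr => m /negbTE ->.
  by move=> m; rewrite /t'; case: ifP => [/eqP ->|//]; lra.
(* The endpoint 0, possibly excluded by [st], is a null set. *)
transitivity (\int[lebesgue_measure]_(a in `[0%R, t m0]) f a)%E.
  by rewrite /I0; case: (st ord0) => //; exact: integral_itv_obnd_cbnd.
under eq_integral do rewrite /f EFinM.
rewrite ge0_integralZr//=; last 2 first.
- apply/measurable_EFinP; apply: measurable_funM => //.
  by apply: measurable_funX; exact: measurable_funB.
- move=> a; rewrite in_itv/= => /andP[? ?].
  by rewrite lee_fin divr_ge0// exprn_ge0// subr_ge0.
rewrite integral_subr_exprn// -EFinM; congr EFin.
rewrite [RHS](bigD1 m0)//= kE eqxx; congr (_ * _).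
by apply: eq_bigr => m mm0; rewrite kE eq_sym (negbTE mm0).
Qed.

End simplices.

(** * Decomposition of the polytope into cells *)

Section cells.
Context {R : realType} (n s : nat).
Local Notation Rt := (measurableTypeR R).
Local Notation Rns := ((n * s).-tuple Rt).
Implicit Types (x : Rns) (phi : {ffun 'I_s -> 'I_n.+1}) (c : 'I_(n * s)).

Definition mxpair c : 'I_n * 'I_s :=
  enum_val (cast_ord (esym (mxvec_cast n s)) c).

Lemma mxpairK i j : mxpair (mxvec_index i j) = (i, j).
Proof. by rewrite /mxpair /mxvec_index cast_ordK enum_rankK. Qed.

(** The adjoined zero row makes the 0 in the maxima of [everest_fun] an ordinary entry. *)
Definition ext_coord x (m : 'I_n.+1) (j : 'I_s) : R :=
  if unlift ord0 m is Some i then everest_coord x i j else 0.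

Lemma ext_coord0 x j : ext_coord x ord0 j = 0.
Proof. by rewrite /ext_coord unlift_none. Qed.

Lemma ext_coord_lift x i j : ext_coord x (lift ord0 i) j = everest_coord x i j.
Proof. by rewrite /ext_coord liftK. Qed.

(* tperm ord0 (phi j) maps the nonzero rows bijectively to the rows other than
   phi j: when row i of x is row phi j, the coordinate (i, j) is reused for the
   entry of u in row 0. *)
Definition cell_row phi c : 'I_n.+1 :=
  tperm ord0 (phi (mxpair c).2) (lift ord0 (mxpair c).1).

Lemma big_cell_row (V : nmodType) phi (F : 'I_n.+1 -> 'I_s -> V) :
  \sum_c F (cell_row phi c) (mxpair c).2 = \sum_j \sum_(m | m != phi j) F m j.
Proof.
rewrite (reindex _ (curry_mxvec_bij n s)) /=.
transitivity (\sum_(p : 'I_n * 'I_s)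
                F (tperm ord0 (phi p.2) (lift ord0 p.1)) p.2).
  by apply: eq_bigr => -[i j] _; rewrite /cell_row /= mxpairK.
rewrite -(pair_bigA _ (fun i j => F (tperm ord0 (phi j) (lift ord0 i)) j)) /=.
rewrite exchange_big /=; apply: eq_bigr => j _.
(* The transposition turns the excluded row [phi j] into row 0, which [big_ord_recl] splits off. *)
rewrite [RHS](reindex_inj (@perm_inj _ (tperm ord0 (phi j)))) /=.
rewrite [RHS]big_mkcond [RHS]big_ord_recl tpermL eqxx /= add0r.
apply: eq_bigr => i _.
by rewrite -[X in _ != X](tpermL ord0 (phi j)) (inj_eq perm_inj).
Qed.

(** Row [m] of u has one free entry in each column [j] with [phi j != m]; this is the dimension of
    its simplex. *)
Lemma card_cell_row phi m :
  #|[pred c | cell_row phi c == m]| = (s - #|[pred j | phi j == m]|)%N.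
Proof.
rewrite -sum1_card big_mkcond /=.
rewrite (@big_cell_row nat phi (fun m' _ => if m' == m then 1%N else 0%N)).
have := cardC [pred j | phi j == m]; rewrite card_ord => cC.
transitivity #|predC [pred j | phi j == m]|; last first.
  by rewrite -[LHS](addKn #|[pred j | phi j == m]|) cC.
rewrite -sum1_card.
rewrite [RHS]big_mkcond; apply: eq_bigr => j _; rewrite !inE.
rewrite -big_mkcondr.
case: eqVneq => [jm|jm] /=.
  by rewrite big_pred0 // => m'; rewrite jm andNb.
rewrite (big_pred1 m)// => m'; rewrite andbC /=.
by case: eqVneq => //= ->; rewrite eq_sym jm.
Qed.

(** A coordinate in row [phi j] of its column is kept, being already the entry of u in row 0; the
    others are reflected about the entry in row [phi j]. This makes the passage to u a shear. *)
Definition cell_map phi : Rns -> Rns :=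
  shear (fun c => lift ord0 (mxpair c).1 != phi (mxpair c).2)
        (fun c x => ext_coord x (phi (mxpair c).2) (mxpair c).2).

Lemma cell_mapE phi x c : tnth (cell_map phi x) c =
  ext_coord x (phi (mxpair c).2) (mxpair c).2 -
  ext_coord x (cell_row phi c) (mxpair c).2 :> R.
Proof.
case/mxvec_indexP: c => i j; rewrite tnth_mktuple /cell_row mxpairK /=.
case: eqVneq => [<-|ij].
  by rewrite tpermR ext_coord_lift ext_coord0 subr0.
by rewrite tpermD ?ext_coord_lift// eq_sym.
Qed.

Lemma measurable_ext_coord m j : measurable_fun setT (fun x => ext_coord x m j).
Proof.
case: (unliftP ord0 m) => [i ->|->].
  under eq_fun do rewrite ext_coord_lift.
  exact: measurable_tnth.
under eq_fun do rewrite ext_coord0.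
exact: measurable_cst.
Qed.

Lemma measurable_cell_map phi : measurable_fun setT (cell_map phi).
Proof. by apply: measurable_shear => c; exact: measurable_ext_coord. Qed.

Lemma lebesgue_tuple_cell_map phi (A : set Rns) : measurable A ->
  lebesgue_tuple R (n * s) (cell_map phi @^-1` A) = lebesgue_tuple R (n * s) A.
Proof.
apply: lebesgue_tuple_shear => [c|c x y xy].
  exact: measurable_ext_coord.
(* The center of reflection is a kept coordinate, or the constant 0 when [phi j] is row 0. *)
rewrite /ext_coord; case: unliftP => // i phii.
by apply: xy; rewrite mxpairK phii eqxx.
Qed.

(* Strict for m < phi j: ties go to the smallest row, so that the cells are
   disjoint. *)
Definition first_argmax phi x := forall j m,
  0 < ext_coord x (phi j) j - ext_coord x m j ?<= if (phi j <= m)%N.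

Lemma first_argmax_ge phi x j m : first_argmax phi x ->
  ext_coord x m j <= ext_coord x (phi j) j.
Proof. by move=> /(_ j m)/lteifW; rewrite subr_ge0. Qed.

Lemma first_argmax_exists x : exists phi, first_argmax phi x.
Proof.
have H j : exists k, forall m,
    0 < ext_coord x k j - ext_coord x m j ?<= if (k <= m)%N.
  (* A maximizer [k0] shows that [Q], the set of rows attaining the maximum of column [j], is
     nonempty; its least element is the witness. *)
  have [k0 _ k0max] :=
    @arg_maxP _ _ 'I_n.+1 ord0 xpredT (fun m => ext_coord x m j) isT.
  pose Q := [pred k | [forall m, ext_coord x m j <= ext_coord x k j]].
  have Qk0 : Q k0 by apply/forallP => m; exact: k0max.
  have [k /forallP Qk kmin] := @arg_minnP _ k0 Q (fun m => m : nat) Qk0.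
  exists k => m; case: leqP => km /=; first by rewrite subr_ge0.
  rewrite subr_gt0 ltNge; apply/negP => kxm.
  move: km; rewrite ltnNge kmin//; apply/forallP => m'.
  exact: le_trans (Qk m') kxm.
have [f fP] := choice H.
by exists [ffun j => f j] => j m; rewrite !ffunE.
Qed.

(** If [phi j < psi j], then [psi] would require its entry to exceed strictly that of row [phi j],
    which is already maximal. *)
Lemma first_argmax_uniq phi psi x :
  first_argmax phi x -> first_argmax psi x -> phi = psi.
Proof.
wlog suff : phi psi / first_argmax phi x -> first_argmax psi x ->
    forall j, (psi j <= phi j)%N.
  move=> H hphi hpsi; apply/ffunP => j; apply/val_inj/eqP; rewrite /= eqn_leq.
  by rewrite !H.
move=> hphi hpsi j; rewrite leqNgt; apply/negP => lt.
have := hpsi j (phi j); rewrite leqNgt lt/=.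
by rewrite subr_gt0 ltNge first_argmax_ge.
Qed.

(** The column maxima sum to the entries along [phi]; bounding the second maximum term by term then
    gives the row sums of u, its 0 accounting for row 0. *)
Lemma everest_argmax phi x : first_argmax phi x ->
  everest R n s x <->
  forall m, \sum_j (ext_coord x (phi j) j - ext_coord x m j) <= 1.
Proof.
move=> phix; rewrite /everest /= /everest_fun.
have -> : \sum_(j < s) \big[Num.max/0]_(i < n) everest_coord x i j =
          \sum_j ext_coord x (phi j) j.
  apply: eq_bigr => j _; apply/eqP; rewrite eq_le; apply/andP; split.
    apply/bigmax_leP; split; first by rewrite -(ext_coord0 x j) first_argmax_ge.
    by move=> i _; rewrite -ext_coord_lift first_argmax_ge.
  have /bigmax_leP[h0 hi] := lexx (\big[Num.max/0]_(i < n) everest_coord x i j).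
  case: (unliftP ord0 (phi j)) => [i ->|->]; last by rewrite ext_coord0.
  by rewrite ext_coord_lift hi.
have sumE m : \sum_j (ext_coord x (phi j) j - ext_coord x m j) =
    \sum_j ext_coord x (phi j) j - \sum_j ext_coord x m j by rewrite sumrB.
rewrite -lerBrDl; split.
  move=> /bigmax_leP[h0 hi] m; rewrite sumE.
  case: (unliftP ord0 m) => [i ->|->].
    under [X in _ - X]eq_bigr do rewrite ext_coord_lift.
    by have := hi i isT; lra.
  rewrite (big1 _ xpredT (ext_coord x ord0)) => [|j _]; first lra.
  exact: ext_coord0.
move=> h; apply/bigmax_leP; split.
  have := h ord0; rewrite sumE.
  rewrite (big1 _ xpredT (ext_coord x ord0)) => [|j _]; first lra.
  exact: ext_coord0.
move=> i _; have := h (lift ord0 i); rewrite sumE.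
under [X in _ - X]eq_bigr do rewrite ext_coord_lift.
lra.
Qed.

Definition cell_simplices phi : set Rns :=
  simplices (cell_row phi) (fun c => (phi (mxpair c).2 <= cell_row phi c)%N)
            (fun=> 1).

(** Entries of u on the graph of [phi] are zero, so sign conditions and row sums involve only the
    remaining entries, which are the coordinates of [cell_map phi x]. *)
Lemma everest_cellE phi :
  everest R n s `&` first_argmax phi = cell_map phi @^-1` cell_simplices phi.
Proof.
have sumE x m : \sum_(c | cell_row phi c == m) (tnth (cell_map phi x) c : R) =
    \sum_j (ext_coord x (phi j) j - ext_coord x m j).
  rewrite big_mkcond /=; under eq_bigr do rewrite cell_mapE.
  rewrite (big_cell_row phi (fun m' j =>
    if m' == m then ext_coord x (phi j) j - ext_coord x m' j else 0)).
  apply: eq_bigr => j _; rewrite -big_mkcondr.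
  have [mj|mj] := eqVneq m (phi j).
    by rewrite mj subrr big_pred0 // => m'; rewrite andNb.
  rewrite (big_pred1 m)// => m'; rewrite andbC /=.
  by case: eqVneq => //= ->.
have argE x : first_argmax phi x <-> forall c,
    0 < (tnth (cell_map phi x) c : R)
      ?<= if (phi (mxpair c).2 <= cell_row phi c)%N.
  split => [h c|h j m]; first by rewrite cell_mapE; exact: h.
  have [->|mj] := eqVneq m (phi j); first by rewrite leqnn /= subrr.
  (* For [m != phi j] the transposed row is nonzero, so the entry (m, j) of u is stored at some (i,
     j). *)
  case: (unliftP ord0 (tperm ord0 (phi j) m)) => [i mi|m0].
    have := h (mxvec_index i j); rewrite cell_mapE /cell_row mxpairK /= -mi.
    by rewrite tpermK.
  move: mj; rewrite -(inj_eq (@perm_inj _ (tperm ord0 (phi j)))) m0.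
  by rewrite tpermR eqxx.
apply/seteqP; split => x /=.
  move=> [Ex hx]; split; first exact/argE.
  by move=> m; rewrite sumE; exact: (everest_argmax hx).1.
move=> [/argE hx h]; split => //; apply/(everest_argmax hx).2 => m.
by rewrite -sumE.
Qed.

End cells.

(** * Summation of the cell volumes *)

Unset Implicit Arguments.

Theorem theorem2 (R : realType) (n s : nat) (hn : (1 <= n)%N) (hs : (1 <= s)%N) :
  lebesgue_tuple R (n * s) (everest R n s) =
  (((n.+1 * s)`!)%:R / (((n * s)`!)%:R * (s`!)%:R ^+ n.+1))%:E.
Proof.
pose cell (phi : {ffun 'I_s -> 'I_n.+1}) := everest R n s `&` first_argmax phi.
have mS phi : measurable (@cell_simplices R n s phi).
  exact: measurable_simplices.
have -> : everest R n s = \bigcup_(phi in setT) cell phi.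
  rewrite -setI_bigcupr; apply/esym/setIidPl => x _.
  by have [phi hphi] := first_argmax_exists x; exists phi.
rewrite measure_fin_bigcup//=; last 2 first.
- by move=> phi psi _ _ [x [[_ h1] [_ h2]]]; exact: first_argmax_uniq h1 h2.
- move=> phi _; rewrite /cell everest_cellE -[X in measurable X]setTI.
  by apply: measurable_cell_map.
rewrite -sum_prod_inv_fact -sumEFin.
(* In this form the finitely supported sum over all [phi] converts to an ordinary big sum. *)
rewrite (_ : setT = [set` index_enum {ffun 'I_s -> 'I_n.+1}]); last first.
  by apply/esym; rewrite -subTset => phi _ /=; rewrite mem_index_enum.
rewrite -fsbig_seq ?index_enum_uniq//.
apply: eq_bigr => phi _.
rewrite /cell everest_cellE lebesgue_tuple_cell_map// lebesgue_tuple_simplices//.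
congr EFin; apply: eq_bigr => m _.
by rewrite expr1n mul1r card_cell_row.
Qed.
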